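(* Let $R$ be a commutative ring with identity and let $n\ge 0$ be an integer. The following statements are equivalent: (1) $R$ is an $n$-SG ring. (2) $\mathrm{Ggldim}(R)\le n$, and for every $R$-module $M$ there exists a short exact sequence of $R$-modules $0\to M\to P\to M\to 0$ with $\mathrm{pd}_R(P)<\infty$. (3) $\mathrm{Ggldim}(R)<\infty$, and for every $R$-module $M$ there exists a short exact sequence of $R$-modules $0\to M\to P\to M\to 0$ with $\mathrm{pd}_R(P)\le n$.
   Context: All rings are commutative with identity and all modules are unitary. $\mathrm{pd}_R(M)$ and $\mathrm{id}_R(M)$ denote the projective and injective dimensions of an $R$-module $M$. Gorenstein projective modules: an $R$-module $M$ is Gorenstein projective if there is an exact sequence of projective $R$-modules $\mathbf{P}:\ \cdots\to P_1\to P_0\to P^0\to P^1\to\cdots$ such that $M\cong \mathrm{Im}(P_0\to P^0)$ and $\mathrm{Hom}_R(-,Q)$ leaves $\mathbf{P}$ exact for every projective $R$-module $Q$. The Gorenstein projective dimension $\mathrm{Gpd}_R(M)$ is defined by resolutions: $\mathrm{Gpd}_R(M)\le k$ if there is an exact sequence $0\to G_k\to\cdots\to G_0\to M\to 0$ with every $G_i$ Gorenstein projective; $\mathrm{Gpd}_R(M)=\infty$ if there is no such $k$. Gorenstein injective modules and the Gorenstein injective dimension $\mathrm{Gid}_R(M)$ are defined dually. The Gorenstein global dimension of $R$ is $\mathrm{Ggldim}(R)=\sup\{\mathrm{Gpd}_R(M)\mid M \text{ an } R\text{-module}\}$; it is known to equal $\sup\{\mathrm{Gid}_R(M)\mid M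 \text{ an } R\text{-module}\}$. Let $n\ge 0$ be an integer. An $R$-module $M$ is strongly $n$-Gorenstein projective if there is a short exact sequence of $R$-modules $0\to M\to P\to M\to 0$ with $\mathrm{pd}_R(P)\le n$, and $\mathrm{Ext}^{n+1}_R(M,Q)=0$ for every projective $R$-module $Q$. An $R$-module $M$ is strongly $n$-Gorenstein injective if there is a short exact sequence of $R$-modules $0\to M\to I\to M\to 0$ with $\mathrm{id}_R(I)\le n$, and $\mathrm{Ext}^{n+1}_R(E,M)=0$ for every injective $R$-module $E$. A ring $R$ is an $n$-SG ring ($n$-strongly Gorenstein) if every $R$-module is strongly $n$-Gorenstein projective; this is known to be equivalent to every $R$-module being strongly $n$-Gorenstein injective. *)

(* Defs.v *)
From mathcomp Require Import all_boot all_algebra.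

Set Implicit Arguments.
Unset Strict Implicit.
Unset Printing Implicit Defensive.

Import GRing.Theory.
Local Open Scope ring_scope.

Definition surjective (A B : Type) (f : A -> B) : Prop :=
  forall y, exists x, f x = y.

(* Exactness of X -> Y -> Z at Y. *)
Definition exact_at (R : comPzRingType) (X Y Z : lmodType R)
    (f : {linear X -> Y}) (g : {linear Y -> Z}) : Prop :=
  forall y, g y = 0 <-> exists x, f x = y.

(* Exactness of Hom(Z, Q) -> Hom(Y, Q) -> Hom(X, Q) at Hom(Y, Q). *)
Definition Hom_exact_at (R : comPzRingType) (X Y Z : lmodType R)
    (f : {linear X -> Y}) (g : {linear Y -> Z}) (Q : lmodType R) : Prop :=
  forall u : {linear Y -> Q},
    (forall x, u (f x) = 0) <->
    (exists v : {linear Z -> Q}, forall y, v (g y) = u y).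

Definition short_exact (R : comPzRingType) (A B C : lmodType R)
    (f : {linear A -> B}) (g : {linear B -> C}) : Prop :=
  [/\ injective f, exact_at f g & surjective g].

Definition projective (R : comPzRingType) (P : lmodType R) : Prop :=
  forall (A B : lmodType R) (g : {linear A -> B}) (f : {linear P -> B}),
    surjective g -> exists h : {linear P -> A}, forall x, g (h x) = f x.

(* ... -> X 1 -> X 0 -> M -> 0 is exact. *)
Definition resolution (R : comPzRingType) (M : lmodType R)
    (X : nat -> lmodType R) (d : forall i, {linear X i.+1 -> X i})
    (e : {linear X 0 -> M}) : Prop :=
  [/\ surjective e, exact_at (d 0) e
    & forall i, exact_at (d i.+1) (d i)].

(* There is an exact sequence 0 -> X k -> ... -> X 0 -> M -> 0 with all X i
   in C; it is extended by zero modules in degrees above k. *)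
Definition resolution_dim_le (R : comPzRingType) (C : lmodType R -> Prop)
    (M : lmodType R) (k : nat) : Prop :=
  exists (X : nat -> lmodType R) (d : forall i, {linear X i.+1 -> X i})
         (e : {linear X 0 -> M}),
    [/\ resolution d e,
        forall i, (i <= k)%N -> C (X i)
      & forall i, (k < i)%N -> forall x : X i, x = 0].

Definition pd_le (R : comPzRingType) (M : lmodType R) (k : nat) : Prop :=
  resolution_dim_le (@projective R) M k.

Definition pd_finite (R : comPzRingType) (M : lmodType R) : Prop :=
  exists k, pd_le M k.

(* The complete resolution ... -> P_1 -> P_0 -> P^0 -> P^1 -> ... is given by
   its left half (PL, dL), its right half (PR, dR) and delta : P_0 -> P^0. *)
Definition gorenstein_projective (R : comPzRingType) (M : lmodType R) : Prop :=
  exists (PL PR : nat -> lmodType R)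
         (dL : forall i, {linear PL i.+1 -> PL i})
         (delta : {linear PL 0 -> PR 0})
         (dR : forall i, {linear PR i -> PR i.+1}),
    [/\ forall i, projective (PL i) /\ projective (PR i),
        [/\ forall i, exact_at (dL i.+1) (dL i),
            exact_at (dL 0) delta,
            exact_at delta (dR 0)
          & forall i, exact_at (dR i) (dR i.+1)],
        forall Q : lmodType R, projective Q ->
        [/\ forall i, Hom_exact_at (dL i.+1) (dL i) Q,
            Hom_exact_at (dL 0) delta Q,
            Hom_exact_at delta (dR 0) Q
          & forall i, Hom_exact_at (dR i) (dR i.+1) Q]
      & (* M is isomorphic to the image of delta *)
        exists j : {linear M -> PR 0},
          injective j /\
          (forall y, (exists x, j x = y) <-> (exists p, delta p = y))].

Definition Gpd_le (R : comPzRingType) (M : lmodType R) (k : nat) : Prop :=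
  resolution_dim_le (@gorenstein_projective R) M k.

Definition Ggldim_le (R : comPzRingType) (k : nat) : Prop :=
  forall M : lmodType R, Gpd_le M k.

Definition Ggldim_finite (R : comPzRingType) : Prop :=
  exists k, Ggldim_le R k.

(* Ext^k_R(M, N) = 0, as vanishing of the k-th cohomology of Hom(X, N) for a
   projective resolution X of M; the choice of X is immaterial. *)
Definition Ext_eq0 (R : comPzRingType) (k : nat) (M N : lmodType R) : Prop :=
  exists (X : nat -> lmodType R) (d : forall i, {linear X i.+1 -> X i})
         (e : {linear X 0 -> M}),
    [/\ resolution d e, forall i, projective (X i)
      & match k with
        | 0 => forall u : {linear X 0 -> N},
                 (forall x, u (d 0 x) = 0) -> forall x, u x = 0
        | k'.+1 => Hom_exact_at (d k'.+1) (d k') N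
        end].

Definition strongly_gorenstein_projective (R : comPzRingType) (n : nat)
    (M : lmodType R) : Prop :=
  (exists (P : lmodType R) (f : {linear M -> P}) (g : {linear P -> M}),
     short_exact f g /\ pd_le P n) /\
  (forall Q : lmodType R, projective Q -> Ext_eq0 n.+1 M Q).

Definition SG_ring (n : nat) (R : comPzRingType) : Prop :=
  forall M : lmodType R, strongly_gorenstein_projective n M.

(* Main.v *)
(** If [R] is [n]-SG, then by the horseshoe lemma the [n]-th syzygy [K] of any
    [M] sits in [0 -> K -> F -> K -> 0] with [F] projective, and
    [Ext^1(K, Q) = Ext^(n+1)(M, Q) = 0]; splicing copies of this sequence makes
    [K] Gorenstein projective, so [Gpd M <= n].  Conversely, modules of
    Gorenstein projective dimension at most [k] have vanishing [Ext^j(-, Q)] for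
    [j > k] and [Q] projective.  Under (2) this forces a module of finite
    projective dimension to have projective dimension at most [n].  Under (3),
    the long exact sequence of [0 -> M -> P -> M -> 0] embeds [Ext^j(M, Q)] into
    [Ext^(j+1)(M, Q)] for [j > n], hence [Ext^(n+1)(M, Q)] into [0].  In all
    cases the sequences [0 -> M -> P -> M -> 0] themselves provide enough
    projectives. *)
Require Import Defs.
From HB Require Import structures.
From mathcomp Require Import all_boot all_algebra.
From Stdlib Require Import IndefiniteDescription.

Set Implicit Arguments.
Unset Strict Implicit.
Unset Printing Implicit Defensive.

Import GRing.Theory.
Local Open Scope ring_scope.

(** * Linear maps: factorization through injections and surjections, kernels as modules *)

Section LinearMaps.
Variable R : comPzRingType.
Implicit Types A B C M N P Q X F K E : lmodType R.

Lemma linear_map_of A B (f : A -> B) :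
  linear f -> exists f' : {linear A -> B}, f' =1 f.
Proof.
move=> lin_f; pose m := GRing.isLinear.Build R A B *:%R f lin_f.
pose f' : {linear A -> B} := HB.pack f m.
by exists f'.
Qed.

Lemma lift_inj K A X (i : {linear K -> A}) (h : {linear X -> A}) :
  injective i -> (forall x, exists k, i k = h x) ->
  exists h' : {linear X -> K}, forall x, i (h' x) = h x.
Proof.
(* Stated with a boolean equation, the preimage can be picked by [xchoose] from the choice structure
   of [K]; injectivity of [i] then makes the choice linear. *)
move=> i_inj im; have im' x : exists k, i k == h x.
  by have [k <-] := im x; exists k.
have [s sK] : exists s, forall x, i (s x) = h x.
  by exists (fun x => xchoose (im' x)) => x; apply/eqP/(xchooseP (im' x)).
have [|h' h'E] := @linear_map_of X K s.
  by move=> a x y; apply: i_inj; rewrite linearP !sK linearP.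
by exists h' => x; rewrite h'E sK.
Qed.

(** Any section of [g] yields the map: as [ker g] lies in [ker h], the chosen preimage does not
    affect the value, which also gives linearity. *)
Lemma desc_surj A C X (g : {linear A -> C}) (h : {linear A -> X}) :
  surjective g -> (forall a, g a = 0 -> h a = 0) ->
  exists h' : {linear C -> X}, forall a, h' (g a) = h a.
Proof.
move=> g_surj ker; have im x : exists a, g a == x.
  by have [a <-] := g_surj x; exists a.
have [s sK] : exists s, forall x, g (s x) = x.
  by exists (fun x => xchoose (im x)) => x; apply/eqP/(xchooseP (im x)).
have hE a b : g a = g b -> h a = h b.
  by move=> gab; apply/eqP; rewrite -subr_eq0 -linearB ker ?linearB ?gab ?subrr.
have [|h' h'E] := @linear_map_of C X (h \o s).
  by move=> a x y /=; rewrite -linearP; apply: hE; rewrite linearP !sK.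
by exists h' => a; rewrite h'E; apply: hE; rewrite sK.
Qed.

Definition kernel A B (g : {linear A -> B}) : pred A := fun x => g x == 0.

Fact kernel_submod_closed A B (g : {linear A -> B}) :
  GRing.submod_closed (kernel g).
Proof.
split=> [|a x y]; rewrite !unfold_in /kernel ?linear0 // linearP.
by move=> /eqP-> /eqP->; rewrite scaler0 addr0.
Qed.

HB.instance Definition _ A B (g : {linear A -> B}) :=
  GRing.isSubmodClosed.Build R A (kernel g) (kernel_submod_closed g).

Record kernel_type A B (g : {linear A -> B}) := KernelType {
  kernel_val : A;
  _ : kernel_val \in kernel g }.

HB.instance Definition _ A B (g : {linear A -> B}) :=
  [isSub for @kernel_val A B g].
HB.instance Definition _ A B (g : {linear A -> B}) :=
  [Choice of kernel_type g by <:].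
HB.instance Definition _ A B (g : {linear A -> B}) :=
  [SubChoice_isSubLmodule of kernel_type g by <:].

Lemma kernelP A B (g : {linear A -> B}) :
  exists (K : lmodType R) (i : {linear K -> A}), injective i /\ exact_at i g.
Proof.
exists (kernel_type g), (val : {linear kernel_type g -> A}).
split=> [|x]; first exact: val_inj.
split=> [gx0|[k <-]]; last by apply/eqP; exact: (valP k).
have xK : x \in kernel g by apply/eqP.
by exists (KernelType xK).
Qed.
End LinearMaps.

(** * Short exact sequences: splitting, pullbacks, projective modules, horseshoe lemma *)

Section ShortExact.
Variable R : comPzRingType.
Implicit Types A B C M N P Q X Y F K E Z : lmodType R.

Lemma zero_module : exists Z : lmodType R, forall z : Z, z = 0.
Proof.
have [Z [i [i_inj exi]]] := kernelP (idfun : {linear R^o -> R^o}).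
by exists Z => z; apply: i_inj; rewrite linear0; apply/(exi (i z)); exists z.
Qed.

Lemma short_exact_ker B C (g : {linear B -> C}) : surjective g ->
  exists (K : lmodType R) (i : {linear K -> B}), short_exact i g.
Proof. by move=> gS; have [K [i [i_inj exi]]] := kernelP g; exists K, i. Qed.

Lemma exact_at_comp0 A B C (f : {linear A -> B}) (g : {linear B -> C}) :
  exact_at f g -> forall a, g (f a) = 0.
Proof. by move=> ex a; apply/ex; exists a. Qed.

Lemma short_exact0 P : exists (Z : lmodType R) (i : {linear Z -> P}),
  (forall z : Z, z = 0) /\ short_exact i (idfun : {linear P -> P}).
Proof.
have [|Z [i sE]] := @short_exact_ker P P idfun; first by move=> y; exists y.
exists Z, i; split=> // z; have [i_inj ex _] := sE.
by apply: i_inj; rewrite linear0; apply/(ex (i z)); exists z.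
Qed.

(** The map [b - s (g b)] lands in the image of [f], which defines [r]. The reversed sequence allows
    [A] to be treated as a quotient of [B]. *)
Lemma short_exact_split A B C (f : {linear A -> B}) (g : {linear B -> C})
    (s : {linear C -> B}) : short_exact f g -> (forall c, g (s c) = c) ->
  exists r : {linear B -> A}, (forall a, r (f a) = a) /\ short_exact s r.
Proof.
move=> [f_inj ex gS] gs.
have [|h hE] := @linear_map_of R B B (fun b => b - s (g b)).
  by move=> a x y; rewrite !linearP /= addrACA scalerDr.
have gf := exact_at_comp0 ex.
have [|r rE] := lift_inj (h := h) f_inj.
  by move=> x; apply/ex; rewrite hE linearB /= gs subrr.
have rf a : r (f a) = a by apply: f_inj; rewrite rE hE gf linear0 subr0.
exists r; split=> //; split; first exact: can_inj gs.
- move=> b; split=> [rb0|[c <-]]; last first.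
    by apply: f_inj; rewrite rE hE gs subrr linear0.
  by exists (g b); apply/eqP; rewrite eq_sym -subr_eq0 -hE -rE rb0 linear0.
- by move=> a; exists (f a).
Qed.

(** [K] is the preimage under [p] of the image of [f], hence an extension of [A] by [N = ker p]. *)
Lemma short_exact_ker_comp N F A B C (i : {linear N -> F}) (p : {linear F -> B})
    (f : {linear A -> B}) (g : {linear B -> C}) :
  short_exact i p -> short_exact f g ->
  exists (K : lmodType R) (j : {linear K -> F}) (a : {linear N -> K}) (b : {linear K -> A}),
    [/\ short_exact j (g \o p), short_exact a b & forall x, j (a x) = i x].
Proof.
move=> [i_inj exi pS] [f_inj exf gS].
have gpS : surjective (g \o p).
  by move=> c; have [b <-] := gS c; have [x <-] := pS b; exists x.
have [K [j sEj]] := short_exact_ker (g := g \o p) gpS.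
have [j_inj exj _] := sEj.
have [|a aE] := lift_inj (h := i) j_inj.
  by move=> x; apply/exj; rewrite /= (exact_at_comp0 exi) linear0.
have [|b bE] := lift_inj (h := p \o j) f_inj.
  by move=> k; apply/exf; apply: (exact_at_comp0 exj).
exists K, j, a, b; split=> //; split.
- by move=> x y /(congr1 j); rewrite !aE => /i_inj.
- move=> k; split=> [bk0|[x <-]]; last first.
    by apply: f_inj; rewrite bE /= aE (exact_at_comp0 exi) linear0.
  have /exi[x xE] : p (j k) = 0 by rewrite -[LHS]bE bk0 linear0.
  by exists x; apply: j_inj; rewrite aE.
- move=> y; have [x xE] := pS (f y).
  have /exj[k kE] : (g \o p) x = 0 by rewrite /= xE (exact_at_comp0 exf).
  by exists k; apply: f_inj; rewrite bE /= kE.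
Qed.

(** Elementwise form of the identification of [E] with the fibre product. It is symmetric in the two
    legs, so one square yields two exact sequences. *)
Definition pullback_square B F C E (g : {linear B -> C}) (p : {linear F -> C})
    (c : {linear E -> B}) (b : {linear E -> F}) : Prop :=
  [/\ forall e, g (c e) = p (b e),
      forall e, c e = 0 -> b e = 0 -> e = 0
    & forall x y, g x = p y -> exists e, c e = x /\ b e = y].

Lemma pullbackP B F C (g : {linear B -> C}) (p : {linear F -> C}) :
  exists (E : lmodType R) (c : {linear E -> B}) (b : {linear E -> F}), pullback_square g p c b.
Proof.
have [|q qE] := @linear_map_of R (B * F)%type C (fun z => g z.1 - p z.2).
  by move=> a x y; rewrite !linearP /= addrACA scalerDr.
have [E [k [k_inj exk]]] := kernelP q.
exists E, (fst \o k : {linear E -> B}), (snd \o k : {linear E -> F}).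
split=> /= [e|e k1 k2|x y gxpy].
- by apply/eqP; rewrite -subr_eq0 -qE (exact_at_comp0 exk).
- by apply: k_inj; rewrite linear0 [k e]surjective_pairing k1 k2.
- have /exk[e eE] : q (x, y) = 0 by rewrite qE /= gxpy subrr.
  by exists e; rewrite eE.
Qed.

Lemma pullback_square_sym B F C E (g : {linear B -> C}) (p : {linear F -> C})
    (c : {linear E -> B}) (b : {linear E -> F}) :
  pullback_square g p c b -> pullback_square p g b c.
Proof.
move=> [com inj ex]; split=> [e|e b0 c0|x y pxgy]; first by rewrite com.
  exact: inj.
by have [e [? ?]] := ex _ _ (esym pxgy); exists e.
Qed.

(** Base change preserves the kernel: inside the fibre product, the kernel of [b] consists of the
    pairs [(f x, 0)]. *)
Lemma pullback_short_exact A B C F E (f : {linear A -> B}) (g : {linear B -> C})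
    (p : {linear F -> C}) (c : {linear E -> B}) (b : {linear E -> F}) :
  pullback_square g p c b -> short_exact f g ->
  exists a : {linear A -> E}, short_exact a b /\ forall x, c (a x) = f x.
Proof.
move=> [com inj ex] [f_inj exf gS]; have gf := exact_at_comp0 exf.
have [|h hE] := @linear_map_of R A (B * F)%type (fun x => (f x, 0)).
  by move=> a x y; congr pair; rewrite ?linearP //= scaler0 addr0.
have [|q qE] := @linear_map_of R E (B * F)%type (fun e => (c e, b e)).
  by move=> a x y; rewrite !linearP.
have q_inj : injective q.
  move=> x y qxy; have : q (x - y) = 0 by rewrite linearB qxy /= subrr.
  rewrite qE => -[c0 b0]; apply/eqP; rewrite -subr_eq0; apply/eqP.
  exact: inj.
have [|a aE] := lift_inj (h := h) q_inj.
  move=> x; have [|e [ce be]] := ex (f x) 0; first by rewrite gf linear0.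
  by exists e; rewrite qE hE ce be.
have caE x : c (a x) = f x /\ b (a x) = 0.
  by have := aE x; rewrite hE qE => -[].
exists a; split=> [|x]; last by have [] := caE x.
split.
- by move=> x y axy; apply: f_inj; rewrite -(caE x).1 -(caE y).1 axy.
- move=> e; split=> [be0|[x <-]]; last by have [] := caE x.
  have /exf[x xE] : g (c e) = 0 by rewrite com be0 linear0.
  exists x; apply: q_inj; rewrite !qE; have [-> ->] := caE x.
  by rewrite xE be0.
- move=> y; have [x xE] := gS (p y).
  by have [e [_ <-]] := ex _ _ xE; exists e.
Qed.

Lemma projective_sum P Q :
  projective P -> projective Q -> projective (P * Q)%type.
Proof.
move=> Pproj Qproj A B g f gS.
have [|f1 f1E] := @linear_map_of R P B (fun x => f (x, 0)).
  move=> a x y; rewrite -linearP; congr (f _).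
  by congr pair; rewrite /= scaler0 addr0.
have [|f2 f2E] := @linear_map_of R Q B (fun x => f (0, x)).
  move=> a x y; rewrite -linearP; congr (f _).
  by congr pair; rewrite /= scaler0 addr0.
have [h1 h1E] := Pproj _ _ g f1 gS.
have [h2 h2E] := Qproj _ _ g f2 gS.
have [|h hE] := @linear_map_of R (P * Q)%type A (fun z => h1 z.1 + h2 z.2).
  by move=> a x y; rewrite !linearP /= scalerDr addrACA.
exists h => -[x y]; rewrite hE linearD /= h1E h2E f1E f2E -linearD.
by congr (f _); congr pair; rewrite /= ?addr0 ?add0r.
Qed.

Lemma projective_retract P Q (s : {linear Q -> P}) (r : {linear P -> Q}) :
  (forall x, r (s x) = x) -> projective P -> projective Q.
Proof.
move=> rs Pproj A B g f gS; have [h hE] := Pproj _ _ g (f \o r) gS.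
by exists (h \o s) => x /=; rewrite hE /= rs.
Qed.

Lemma inverse_linear A B (f : {linear A -> B}) : injective f -> surjective f ->
  exists g : {linear B -> A}, (forall x, g (f x) = x) /\ forall y, f (g y) = y.
Proof.
move=> f_inj fS; have [|g gE] := lift_inj (h := idfun : {linear B -> B}) f_inj.
  by move=> x; have [y <-] := fS x; exists y.
by exists g; split=> // x; apply: f_inj; rewrite gE.
Qed.

Lemma projective_iso A B (f : {linear A -> B}) :
  injective f -> surjective f -> projective A -> projective B.
Proof.
move=> f_inj fS; have [g [_ fg]] := inverse_linear f_inj fS.
exact: projective_retract fg.
Qed.

Lemma projective0 Z : (forall z : Z, z = 0) -> projective Z.
Proof.
move=> Z0 A B g f gS; exists (\0 : {linear Z -> A}) => x.
by rewrite (Z0 x) !linear0.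
Qed.

Lemma projective_section B P (g : {linear B -> P}) :
  projective P -> surjective g -> exists s : {linear P -> B}, forall x, g (s x) = x.
Proof. by move=> Pproj gS; apply: (Pproj _ _ g idfun gS). Qed.

(** With [t] a lift of [pC] through [g], the map [f (pA z.1) + t z.2] covers [B]; the second
    coordinate maps its kernel onto [NC] with kernel [NA]. *)
Lemma horseshoe A B C (NA FA NC FC : lmodType R)
    (f : {linear A -> B}) (g : {linear B -> C})
    (iA : {linear NA -> FA}) (pA : {linear FA -> A})
    (iC : {linear NC -> FC}) (pC : {linear FC -> C}) :
  short_exact f g -> short_exact iA pA -> short_exact iC pC -> projective FC ->
  exists (K : lmodType R) (j : {linear K -> (FA * FC)%type}) (q : {linear (FA * FC)%type -> B})
         (a : {linear NA -> K}) (b : {linear K -> NC}),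
    short_exact j q /\ short_exact a b.
Proof.
move=> [f_inj exf gS] [iA_inj exA pAS] [iC_inj exC pCS] FCproj.
have gf := exact_at_comp0 exf.
have [t tE] := FCproj _ _ g pC gS.
have [|q qE] :=
    @linear_map_of R (FA * FC)%type B (fun z => f (pA z.1) + t z.2).
  by move=> a x y; rewrite !linearP /= scalerDr addrACA.
have qS : surjective q.
  move=> y; have [c cE] := pCS (g y).
  have /exf[a aE] : g (y - t c) = 0 by rewrite linearB /= tE cE subrr.
  have [x xE] := pAS a.
  by exists (x, c); rewrite qE /= xE aE subrK.
have [K [j sEj]] := short_exact_ker qS.
have [j_inj exj _] := sEj.
have qj := exact_at_comp0 exj.
have [|h hE] := @linear_map_of R NA (FA * FC)%type (fun x => (iA x, 0)).
  by move=> a x y; congr pair; rewrite ?linearP //= scaler0 addr0.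
have [|a aE] := lift_inj (h := h) j_inj.
  move=> x; apply/exj; rewrite hE qE /= (exact_at_comp0 exA).
  by rewrite !linear0 addr0.
have [|b bE] := lift_inj (h := (snd \o j : {linear K -> FC})) iC_inj.
  move=> k; apply/exC => /=; rewrite -tE.
  by have := congr1 g (qj k); rewrite qE linearD /= gf add0r linear0.
exists K, j, q, a, b; split=> //; split.
- by move=> x y /(congr1 j); rewrite !aE !hE => -[/iA_inj].
- move=> k; split=> [bk0|[x <-]]; last first.
    by apply: iC_inj; rewrite bE /= aE hE linear0.
  have k2 : (j k).2 = 0 by rewrite -[LHS]bE bk0 linear0.
  have /exA[x xE] : pA (j k).1 = 0.
    by apply: f_inj; have := qj k; rewrite qE k2 !linear0 addr0.
  by exists x; apply: j_inj; rewrite aE hE xE [j k]surjective_pairing k2.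
(* Surjectivity of [b]: [t (iC y)] lies in the image of [f], so a first coordinate can be chosen to
   cancel it. *)
- move=> y; have /exf[x xE] : g (t (iC y)) = 0.
    by rewrite tE (exact_at_comp0 exC).
  have [z zE] := pAS x.
  have /exj[k kE] : q (- z, iC y) = 0.
    by rewrite qE /= !linearN /= zE xE addNr.
  by exists k; apply: iC_inj; rewrite bE /= kE.
Qed.
End ShortExact.

(** * Vanishing of Ext: dimension shifting and comparison with resolutions *)

Section ExtVanishing.
Variable R : comPzRingType.
Implicit Types A B C M N P Q X Y F K E Z : lmodType R.

(* [ext_vanish k M Q] encodes [Ext^(k+1)(M, Q) = 0], by dimension shifting;
   mind the offset in the degree. *)
Fixpoint ext_vanish (k : nat) M Q : Prop :=
  match k with
  | 0 => forall A B (f : {linear A -> B}) (g : {linear B -> M}),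
      short_exact f g -> forall u : {linear A -> Q},
      exists v : {linear B -> Q}, forall x, v (f x) = u x
  | k.+1 => exists N F (i : {linear N -> F}) (p : {linear F -> M}),
      [/\ short_exact i p, projective F & ext_vanish k N Q]
  end.

Lemma ext_vanish_projective k P Q : projective P -> ext_vanish k P Q.
Proof.
elim: k P => [|k IHk] P Pproj /=.
  move=> A B f g sE u; have [_ _ gS] := sE.
  have [s gs] := projective_section Pproj gS.
  have [r [rf _]] := short_exact_split sE gs.
  by exists (u \o r) => x /=; rewrite rf.
have [Z [i [Z0 sE]]] := short_exact0 P.
by exists Z, P, i, idfun; split=> //; apply/IHk/projective0.
Qed.

(** Pull the sequence back along [r] to one ending in [E], extend [u] there, and return to [B] along
    [y |-> (y, s (g y))]. *)
Lemma ext_vanish_retract M E Q (s : {linear M -> E}) (r : {linear E -> M}) :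
  (forall x, r (s x) = x) -> ext_vanish 0 E Q -> ext_vanish 0 M Q.
Proof.
move=> rs EQ A B f g sE u.
have [Y [c [b sq]]] := pullbackP g r.
have [a [sEa ca]] := pullback_short_exact sq sE.
have [v vE] := EQ _ _ _ _ sEa u.
have [_ inj ex] := sq.
have [|h hE] := @linear_map_of R B (B * E)%type (fun y => (y, s (g y))).
  by move=> t x y; rewrite !linearP.
have [|q qE] := @linear_map_of R Y (B * E)%type (fun e => (c e, b e)).
  by move=> t x y; rewrite !linearP.
have q_inj : injective q.
  move=> x y qxy; have : q (x - y) = 0 by rewrite linearB qxy /= subrr.
  rewrite qE => -[c0 b0]; apply/eqP; rewrite -subr_eq0; apply/eqP.
  exact: inj.
have [|w wE] := lift_inj (h := h) q_inj.
  move=> y; have [|e [ce be]] := ex y (s (g y)); first by rewrite rs.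
  by exists e; rewrite qE hE ce be.
exists (v \o w) => x /=; rewrite -vE; congr (v _); apply: q_inj.
have [_ exf _] := sE; have [_ exa _] := sEa.
rewrite wE hE qE ca (exact_at_comp0 exa) (exact_at_comp0 exf).
by rewrite linear0.
Qed.

(** In the base case a map is extended in two stages, first to the kernel of the composite onto [C],
    using [A], then to the whole module, using [C]. The horseshoe lemma passes to syzygies. *)
Lemma ext_vanish_extension k A B C Q (f : {linear A -> B}) (g : {linear B -> C}) :
  short_exact f g -> ext_vanish k A Q -> ext_vanish k C Q -> ext_vanish k B Q.
Proof.
elim: k A B C f g => [|k IHk] A B C f g sE /=.
  move=> AQ CQ X Y i p sEi u.
  have [K [j [a [b [sEj sEa ja]]]]] := short_exact_ker_comp sEi sE.
  have [v vE] := AQ _ _ _ _ sEa u.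
  have [w wE] := CQ _ _ _ _ sEj v.
  by exists w => x; rewrite -ja wE vE.
move=> [NA [FA [iA [pA [sEA FAproj AQ]]]]] [NC [FC [iC [pC [sEC FCproj CQ]]]]].
have [K [j [q [a [b [sEj sEa]]]]]] := horseshoe sE sEA sEC FCproj.
exists K, (FA * FC)%type, j, q; split=> //; first exact: projective_sum.
exact: IHk sEa AQ CQ.
Qed.

(** The kernel of [F -> B -> C] is a syzygy of [C] and an extension of [A] by the syzygy [N] of
    [B]. *)
Lemma ext_vanish_quotient k A B C Q (f : {linear A -> B}) (g : {linear B -> C}) :
  short_exact f g -> ext_vanish k A Q -> ext_vanish k.+1 B Q ->
  ext_vanish k.+1 C Q.
Proof.
move=> sE AQ [N [F [i [p [sEi Fproj NQ]]]]].
have [K [j [a [b [sEj sEa _]]]]] := short_exact_ker_comp sEi sE.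
by exists K, F, j, (g \o p); split=> //; exact: ext_vanish_extension sEa NQ AQ.
Qed.

(** As in Schanuel's lemma, the pullback [E] of [B -> C <- F] is an extension of [B] by [N] and also
    of [F] by [A]. The latter splits, so vanishing passes from [E] to [A]. *)
Lemma ext_vanish_sub k A B C Q (f : {linear A -> B}) (g : {linear B -> C}) :
  short_exact f g -> ext_vanish k B Q -> ext_vanish k.+1 C Q ->
  ext_vanish k A Q.
Proof.
move=> sE BQ [N [F [i [p [sEi Fproj NQ]]]]].
have [E [c [b sq]]] := pullbackP g p.
have [a [sEa _]] := pullback_short_exact sq sE.
have [a' [sEa' _]] := pullback_short_exact (pullback_square_sym sq) sEi.
have EQ := ext_vanish_extension sEa' NQ BQ.
have [_ _ bS] := sEa.
have [s bs] := projective_section Fproj bS.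
have [r [ra sEs]] := short_exact_split sEa bs.
(* [ext_vanish_quotient] concludes only at successor indices; at index 0, [A] is used as a retract
   of [E]. *)
case: k EQ {BQ NQ} => [|k] EQ; first exact: ext_vanish_retract ra EQ.
exact: ext_vanish_quotient sEs (ext_vanish_projective k Q Fproj) EQ.
Qed.

(** The recursive clause of [ext_vanish] asks for some projective cover; by [ext_vanish_sub] every
    other one serves equally well. *)
Lemma ext_vanish_syzygy k N F M Q (i : {linear N -> F}) (p : {linear F -> M}) :
  short_exact i p -> projective F ->
  ext_vanish k.+1 M Q <-> ext_vanish k N Q.
Proof.
move=> sE Fproj; split=> [|NQ]; last by exists N, F, i, p.
exact/(ext_vanish_sub sE)/ext_vanish_projective.
Qed.

Lemma ext_vanish0_presentation X1 X0 M Q (d : {linear X1 -> X0})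
    (e : {linear X0 -> M}) :
  projective X0 -> surjective e -> exact_at d e ->
  (forall u : {linear X1 -> Q}, (forall x, d x = 0 -> u x = 0) ->
     exists v : {linear X0 -> Q}, forall x, v (d x) = u x) ->
  ext_vanish 0 M Q.
Proof.
move=> X0proj eS exd ext A B f g [f_inj exf gS] u.
have [t tE] := X0proj _ _ g e gS.
have [|h hE] := lift_inj (h := t \o d) f_inj.
  by move=> x; apply/exf; rewrite /= tE (exact_at_comp0 exd).
have [|v vE] := ext (u \o h).
  move=> x dx0; rewrite /= (_ : h x = 0) ?linear0 //.
  by apply: f_inj; rewrite hE /= dx0 !linear0.
(* [B] is the quotient of [A * X0] by the pairs [(- h y, d y)]; [u] and [v] together vanish on
   these, hence glue to a map on [B]. *)
have [|q qE] := @linear_map_of R (A * X0)%type B (fun z => f z.1 + t z.2).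
  by move=> a x y; rewrite !linearP /= scalerDr addrACA.
have [|w wE] := @linear_map_of R (A * X0)%type Q (fun z => u z.1 + v z.2).
  by move=> a x y; rewrite !linearP /= scalerDr addrACA.
have [||w' w'E] := desc_surj (g := q) (h := w).
- move=> y; have [x xE] := eS (g y).
  have /exf[a aE] : g (y - t x) = 0 by rewrite linearB /= tE xE subrr.
  by exists (a, x); rewrite qE /= aE subrK.
- move=> [a x]; rewrite qE wE /= => q0.
  have /exd[y yE] : e x = 0.
    have := congr1 g q0.
    by rewrite linearD /= tE (exact_at_comp0 exf) add0r linear0.
  have -> : a = - h y.
    apply: f_inj; apply/eqP; rewrite linearN /= hE /= yE -addr_eq0; exact/eqP.
  by rewrite -yE vE linearN /= addNr.
- exists w' => x; have := w'E (x, 0).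
  by rewrite qE wE /= !linear0 !addr0.
Qed.

Lemma resolution_shift M (X : nat -> lmodType R)
    (d : forall i, {linear X i.+1 -> X i}) (e : {linear X 0 -> M}) :
  resolution d e ->
  exists N (i : {linear N -> X 0}) (e' : {linear X 1 -> N}),
    [/\ short_exact i e, forall x, i (e' x) = d 0 x
      & @resolution R N (fun i => X i.+1) (fun i => d i.+1) e'].
Proof.
move=> [eS exd0 exd]; have [N [i sE]] := short_exact_ker eS.
have [i_inj exi _] := sE.
have [|e' e'E] := lift_inj (h := d 0) i_inj.
  by move=> x; apply/exi; rewrite (exact_at_comp0 exd0).
exists N, i, e'; split=> //; split=> //.
  move=> y; have [x xE] : exists x, d 0 x = i y.
    by apply/exd0; rewrite (exact_at_comp0 exi).
  by exists x; apply: i_inj; rewrite e'E.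
move=> x; have -> : (e' x = 0) <-> (d 0 x = 0).
  split=> [ex0|dx0]; first by rewrite -e'E ex0 linear0.
  by apply: i_inj; rewrite e'E dx0 linear0.
exact: exd.
Qed.

(** Shifting the resolution reduces to [k = 0], where a map killing the image of [d 1] is the same
    as a map on [ker e]. As the resolution is arbitrary, the choice made in [Ext_eq0] is
    harmless. *)
Lemma Hom_exact_ext_vanish k M Q (X : nat -> lmodType R)
    (d : forall i, {linear X i.+1 -> X i}) (e : {linear X 0 -> M}) :
  resolution d e -> (forall i, projective (X i)) ->
  Hom_exact_at (d k.+1) (d k) Q <-> ext_vanish k M Q.
Proof.
elim: k M X d e => [|k IHk] M X d e res Xproj.
  have [eS exd0 exd] := res; split=> [HQ|MQ u].
    apply: (ext_vanish0_presentation (Xproj 0) eS exd0) => u ker_u.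
    by apply/HQ => x; apply/ker_u/(exact_at_comp0 (exd 0)).
  split=> [u0|[v vE] x]; last by rewrite -vE (exact_at_comp0 (exd 0)) linear0.
  have [N [i [e' [sE ie' [e'S exd1 _]]]]] := resolution_shift res.
  have [|u' u'E] := desc_surj (h := u) e'S; first by move=> x /exd1[y <-].
  by have [v vE] := MQ _ _ _ _ sE u'; exists v => x; rewrite -ie' vE u'E.
have [N [i [e' [sE ie' res']]]] := resolution_shift res.
have -> := ext_vanish_syzygy k Q sE (Xproj 0).
by apply: (IHk _ (fun i => X i.+1) (fun i => d i.+1) _ res') => j; apply: Xproj.
Qed.

Lemma Ext_eq0_ext_vanish k M Q : Ext_eq0 k.+1 M Q -> ext_vanish k M Q.
Proof.
move=> [X [d [e [res Xproj HQ]]]].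
exact/(Hom_exact_ext_vanish k Q res Xproj).
Qed.

(** * Enough projectives and the construction of projective resolutions *)

Definition enough_projectives : Prop :=
  forall M, exists F (p : {linear F -> M}), projective F /\ surjective p.

Lemma projective_resolution M : enough_projectives ->
  exists (X : nat -> lmodType R) (d : forall i, {linear X i.+1 -> X i})
    (e : {linear X 0 -> M}), resolution d e /\ forall i, projective (X i).
Proof.
move=> EP.
(* Syzygy, cover and both maps are packed into one dependent tuple so that a single use of choice
   selects them coherently for every [N]. *)
have cover N : exists c : {K : lmodType R & {F : lmodType R &
    ({linear K -> F} * {linear F -> N})%type}},
    short_exact (projT2 (projT2 c)).1 (projT2 (projT2 c)).2 /\
    projective (projT1 (projT2 c)).
  have [F [p [Fproj pS]]] := EP N.
  have [K [i sE]] := short_exact_ker pS.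
  by exists (existT _ K (existT _ F (i, p))).
pose c N := proj1_sig (constructive_indefinite_description _ (cover N)).
have cP N : short_exact (projT2 (projT2 (c N))).1 (projT2 (projT2 (c N))).2 /\
    projective (projT1 (projT2 (c N))).
  by rewrite /c; case: constructive_indefinite_description.
(* [S i] is the [i]-th syzygy of [M]; the differentials are the composites
   [X i.+1 -> S i.+1 -> X i]. *)
pose S := fix S (i : nat) : lmodType R :=
  if i is i'.+1 then projT1 (c (S i')) else M.
pose X i : lmodType R := projT1 (projT2 (c (S i))).
pose p i : {linear X i -> S i} := (projT2 (projT2 (c (S i)))).2.
pose j i : {linear S i.+1 -> X i} := (projT2 (projT2 (c (S i)))).1.
have sE i : short_exact (j i) (p i) := proj1 (cP (S i)).
exists X, (fun i => (j i \o p i.+1 : {linear X i.+1 -> X i})), (p 0).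
have ex i x : p i x = 0 <-> exists y, j i (p i.+1 y) = x.
  have [j_inj exj _] := sE i; have [_ _ pS] := sE i.+1.
  split=> [/exj[y <-]|[y <-]]; last exact: exact_at_comp0 exj _.
  by have [z <-] := pS y; exists z.
split; last by move=> i; apply: proj2 (cP (S i)).
split; [by have [] := sE 0 | exact: ex |] => i x.
rewrite -[X in _ <-> X]ex /=; have [j_inj _ _] := sE i.
by split=> [jx0|->]; [apply: j_inj; rewrite jx0 |]; rewrite linear0.
Qed.

Lemma ext_vanish_Ext_eq0 k M Q :
  enough_projectives -> ext_vanish k M Q -> Ext_eq0 k.+1 M Q.
Proof.
move=> EP MQ; have [X [d [e [res Xproj]]]] := projective_resolution M EP.
by exists X, d, e; split=> //; apply/(Hom_exact_ext_vanish _ _ res Xproj).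
Qed.
End ExtVanishing.

(** * Projective dimension and dimensions relative to a class of modules *)

Section Dimensions.
Variable R : comPzRingType.
Implicit Types A B C M N P Q X Y F G K E Z : lmodType R.
Implicit Type Cl : lmodType R -> Prop.

Definition iso_closed Cl : Prop := forall A B (f : {linear A -> B}),
  injective f -> surjective f -> Cl A -> Cl B.

(** A resolution of length 0 gives only an isomorphism from [X 0] to [M], whence the closure
    condition on [Cl]. *)
Lemma resolution_dim_le0 Cl M :
  iso_closed Cl -> resolution_dim_le Cl M 0 <-> Cl M.
Proof.
move=> Cl_iso; split=> [[X [d [e [[eS exd0 _] XCl X0]]]]|MCl].
  apply: (Cl_iso _ _ e) (XCl 0%N _) => // x y exy.
  apply/eqP; rewrite -subr_eq0; apply/eqP.
  have /exd0[z <-] : e (x - y) = 0 by rewrite linearB exy /= subrr.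
  by rewrite (X0 1%N isT z) linear0.
have [Z Z0] := zero_module R.
pose X i : lmodType R := if i is 0 then M else Z.
exists X, (fun i => \0 : {linear X i.+1 -> X i}), (idfun : {linear M -> M}).
split=> [|[|i] //|[|i] //].
split=> [y|y|i y]; first by exists y.
  by split=> [/= ->|[x <-]] //=; exists (0 : Z).
by split=> // _; exists (0 : Z); rewrite [y]Z0 linear0.
Qed.

Lemma resolution_dim_leS Cl M k :
  resolution_dim_le Cl M k.+1 <->
  exists N F (i : {linear N -> F}) (p : {linear F -> M}),
    [/\ short_exact i p, Cl F & resolution_dim_le Cl N k].
Proof.
split=> [[X [d [e [res XCl X0]]]]|].
  have [N [i [e' [sE _ res']]]] := resolution_shift res.
  exists N, (X 0), i, e; split=> //; first exact: XCl.
  by exists (fun i => X i.+1), (fun i => d i.+1), e'; split=> // j lejk;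
     [exact: (XCl j.+1) | exact: (X0 j.+1)].
move=> [N [F [i [p [[i_inj exi pS] FCl [X [d [e [[eS exd0 exd] XCl X0]]]]]]]]].
pose Y j : lmodType R := if j is j'.+1 then X j' else F.
pose dY j : {linear Y j.+1 -> Y j} :=
  if j is j'.+1 then d j' else i \o e.
exists Y, dY, p; split=> [|[|j] //|[|j] //]; last 2 first.
- exact: XCl.
- exact: X0.
split=> //.
  move=> y; rewrite exi; split=> [[x <-]|[x <-]]; last by exists (e x).
  by have [z <-] := eS x; exists z.
case=> [|j] //= y; rewrite -exd0 /=.
by split=> [iey|->]; [apply: i_inj; rewrite iey|]; rewrite linear0.
Qed.

(** Index [j] stands for degree [j + 1], so [k <= j] covers exactly the degrees above [k]. *)
Lemma resolution_dim_ext_vanish Cl M Q k j :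
  iso_closed Cl -> (forall G i, Cl G -> ext_vanish i G Q) ->
  resolution_dim_le Cl M k -> (k <= j)%N -> ext_vanish j M Q.
Proof.
move=> Cl_iso ClQ; elim: k M j => [|k IHk] M j.
  by move=> /(resolution_dim_le0 _ Cl_iso) MCl _; apply: ClQ.
move=> /resolution_dim_leS[N [F [i [p [sE FCl Nk]]]]]; case: j => // j lekj.
exact: ext_vanish_quotient sE (IHk N j Nk lekj) (ClQ F j.+1 FCl).
Qed.

Lemma pd_le_ext_vanish M Q k j :
  pd_le M k -> (k <= j)%N -> ext_vanish j M Q.
Proof.
apply: resolution_dim_ext_vanish => [A B f|G i]; first exact: projective_iso.
exact: ext_vanish_projective.
Qed.

Lemma pd_le0 M : pd_le M 0 <-> projective M.
Proof. by apply: resolution_dim_le0 => A B f; apply: projective_iso. Qed.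

(** Extending the identity of [N] to [F] splits the sequence, so [M] is a retract of [F]. *)
Lemma projective_ext_vanish N F M (i : {linear N -> F}) (p : {linear F -> M}) :
  short_exact i p -> projective F -> ext_vanish 0 M N -> projective M.
Proof.
move=> sE Fproj MN; have [i_inj exi pS] := sE.
have [r ri] := MN _ _ _ _ sE idfun.
have [|h hE] := @linear_map_of R F F (fun x => x - i (r x)).
  by move=> a x y; rewrite !linearP /= addrACA scalerDr.
have [|s sE'] := desc_surj (h := h) pS.
  by move=> x /exi[y <-]; rewrite hE ri subrr.
apply: (projective_retract (s := s) (r := p)) Fproj => x.
have [y <-] := pS x.
by rewrite sE' hE linearB /= (exact_at_comp0 exi) subr0.
Qed.

Lemma pd_le_of_ext_vanish M n :
  enough_projectives R -> (forall Q, ext_vanish n M Q) -> pd_le M n.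
Proof.
move=> EP; elim: n M => [|n IHn] M MQ; have [F [p [Fproj pS]]] := EP M;
  have [N [i sE]] := short_exact_ker pS.
  exact/pd_le0/(projective_ext_vanish sE Fproj (MQ N)).
apply/resolution_dim_leS; exists N, F, i, p; split=> //; apply: IHn => Q.
exact/(ext_vanish_syzygy n Q sE Fproj).
Qed.

(** Projective test modules suffice because the induction runs along a finite projective resolution:
    once the syzygy [N] is known to be projective, it can itself serve as the test module. *)
Lemma pd_finite_le M n : pd_finite M ->
  (forall Q j, projective Q -> (n <= j)%N -> ext_vanish j M Q) -> pd_le M n.
Proof.
move=> [k]; elim: k M n => [|k IHk] M n.
  move=> /pd_le0 Mproj _; elim: n M Mproj => [|n IHn] M Mproj; first exact/pd_le0.
  have [Z [i [Z0 sE]]] := short_exact0 M.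
  apply/resolution_dim_leS; exists Z, M, i, idfun; split=> //.
  exact/IHn/projective0.
move=> /resolution_dim_leS[N [F [i [p [sE Fproj Nk]]]]] MQ.
(* Here [m] stands for the predecessor of [n], truncated at 0, so that both cases of [n] are
   covered. *)
have NQ m Q j : (n <= m.+1)%N -> projective Q -> (m <= j)%N -> ext_vanish j N Q.
  move=> lenm Qproj lemj; apply/(ext_vanish_syzygy j Q sE Fproj)/MQ => //.
  exact: leq_trans lenm _.
case: n MQ NQ => [|n] MQ NQ.
  have /pd_le0 Nproj := IHk N 0%N Nk (fun Q j => NQ 0%N Q j isT).
  exact/pd_le0/(projective_ext_vanish sE Fproj (MQ N 0%N Nproj isT)).
apply/resolution_dim_leS; exists N, F, i, p; split=> //.
by apply: IHk Nk _ => Q j; apply: NQ.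
Qed.

(** * Gorenstein projective modules and self-extensions *)

Lemma gorenstein_projective_iso_closed :
  iso_closed (@gorenstein_projective R).
Proof.
move=> A B f f_inj fS [PL [PR [dL [delta [dR [proj ex Hex [j [j_inj imj]]]]]]]].
have [g [gf fg]] := inverse_linear f_inj fS.
exists PL, PR, dL, delta, dR; split=> //; exists (j \o g); split.
  exact: inj_comp j_inj (can_inj fg).
move=> y; rewrite -imj; split=> [[x <-]|[x <-]]; first by exists (g x).
by exists (f x); rewrite /= gf.
Qed.

(** The left half of a complete resolution is a projective resolution of [G], and its Hom-exactness
    is the vanishing of Ext. *)
Lemma gorenstein_projective_ext_vanish G Q i :
  projective Q -> gorenstein_projective G -> ext_vanish i G Q.
Proof.
move=> Qproj [PL [PR [dL [delta [dR [proj [exL ex0 _ _] Hex [j [j_inj imj]]]]]]]].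
have [|e eE] := lift_inj (h := delta) j_inj.
  by move=> x; apply/imj; exists x.
have res : resolution dL e.
  split=> // [y|x].
    have /imj[x xE] : exists x, j x = j y by exists y.
    by exists x; apply: j_inj; rewrite eE.
  rewrite -ex0 -eE.
  by split=> [->|ex]; [|apply: j_inj; rewrite ex]; rewrite linear0.
have [HexL _ _ _] := Hex Q Qproj.
by apply/(Hom_exact_ext_vanish i Q res) => // k; case: (proj k).
Qed.

Lemma Gpd_le_ext_vanish M Q k j : projective Q ->
  Gpd_le M k -> (k <= j)%N -> ext_vanish j M Q.
Proof.
move=> Qproj; apply: resolution_dim_ext_vanish => [|G i].
  exact: gorenstein_projective_iso_closed.
exact: gorenstein_projective_ext_vanish.
Qed.

Lemma Gpd_le0 M : Gpd_le M 0 <-> gorenstein_projective M.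
Proof. exact/resolution_dim_le0/gorenstein_projective_iso_closed. Qed.

Lemma gorenstein_projective_self_extension M F (f : {linear M -> F})
    (g : {linear F -> M}) :
  short_exact f g -> projective F ->
  (forall Q, projective Q -> ext_vanish 0 M Q) -> gorenstein_projective M.
Proof.
move=> sE Fproj MQ; have [f_inj exf gS] := sE.
have gf := exact_at_comp0 exf.
(* All differentials of the complete resolution equal [d], whose kernel and image are both the image
   of [f]. *)
pose d : {linear F -> F} := f \o g.
have exd : exact_at d d.
  move=> y; split=> [dy0|[x <-]]; last by rewrite /d /= gf linear0.
  have /exf[x <-] : g y = 0 by apply: f_inj; rewrite linear0.
  by have [z <-] := gS x; exists z.
have Hexd Q : projective Q -> Hom_exact_at d d Q.
  move=> Qproj u; split=> [ud0|[v vE] x]; last by rewrite -vE /d /= gf !linear0.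
  have [|w wE] := desc_surj (h := u) gS.
    move=> y /exf[x <-]; have [z <-] := gS x; exact: ud0.
  have [v vE] := MQ Q Qproj _ _ _ _ sE w.
  by exists v => y; rewrite /d /= vE wE.
exists (fun=> F), (fun=> F), (fun=> d), d, (fun=> d); split=> //.
  by move=> Q /Hexd.
exists f; split=> // y; split=> [[x <-]|[x <-]]; last by exists (g x).
by have [z <-] := gS x; exists z.
Qed.

(** The split sequence [0 -> P -> P * P -> P -> 0] is a self-extension with projective middle
    term. *)
Lemma projective_gorenstein_projective P :
  projective P -> gorenstein_projective P.
Proof.
move=> Pproj.
have [|f fE] := @linear_map_of R P (P * P)%type (fun x => (x, 0)).
  by move=> a x y; congr pair; rewrite /= scaler0 addr0.
apply: (gorenstein_projective_self_extension
    (f := f) (g := (snd : {linear (P * P)%type -> P}))).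
- split.
  + by move=> x y; rewrite !fE => -[].
  + move=> [x y] /=; split=> [->|[z]]; first by exists x; rewrite fE.
    by rewrite fE => -[].
  + by move=> x; exists (0, x).
- exact: projective_sum.
- by move=> Q _; exact: ext_vanish_projective.
Qed.

(** The horseshoe lemma with the same cover at both ends turns a self-extension of [M] into one of
    its syzygy [N]. The new middle term [K] is a syzygy of [P], so its dimension bound drops by
    one. *)
Lemma self_extension_Gpd_le M P n (f : {linear M -> P}) (g : {linear P -> M}) :
  enough_projectives R -> short_exact f g -> pd_le P n ->
  (forall Q, projective Q -> ext_vanish n M Q) -> Gpd_le M n.
Proof.
move=> EP; elim: n M P f g => [|n IHn] M P f g sE Pn MQ.
  apply/Gpd_le0/(gorenstein_projective_self_extension sE) => //.
  exact/pd_le0.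
have [F [p [Fproj pS]]] := EP M; have [N [i sEi]] := short_exact_ker pS.
have [K [j [q [a [b [sEj sEa]]]]]] := horseshoe sE sEi sEi Fproj.
apply/resolution_dim_leS; exists N, F, i, p; split=> //.
  exact: projective_gorenstein_projective.
apply: IHn sEa _ _ => [|Q Qproj].
  apply: pd_le_of_ext_vanish => // Q.
  apply/(ext_vanish_syzygy n Q sEj); first exact: projective_sum.
  exact: pd_le_ext_vanish Pn _.
exact/(ext_vanish_syzygy n Q sEi Fproj)/MQ.
Qed.

Lemma enough_projectives_pd_finite :
  (forall M, exists P (f : {linear M -> P}) (g : {linear P -> M}),
     short_exact f g /\ pd_finite P) -> enough_projectives R.
Proof.
move=> ext M.
have [P [f [g [[_ _ gS] [k [X [d [e [[eS _ _] Xproj _]]]]]]]]] := ext M.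
exists (X 0), (g \o e); split; first exact: Xproj.
by move=> x; have [y <-] := gS x; have [z <-] := eS y; exists z.
Qed.

Lemma SG_ring_Ggldim_le n : SG_ring n R -> Ggldim_le R n.
Proof.
move=> SG M; have [[P [f [g [sE Pn]]]] MQ] := SG M.
apply: self_extension_Gpd_le sE Pn _ => [|Q /MQ]; last exact: Ext_eq0_ext_vanish.
apply: enough_projectives_pd_finite => N.
have [[P' [f' [g' [sE' Pn']]]] _] := SG N.
by exists P', f', g'; split=> //; exists n.
Qed.

(** Since [M] is both the submodule and the quotient, [ext_vanish_sub] lowers the index by one for
    as long as it stays at least [n], where Ext of [P] vanishes. *)
Lemma self_extension_ext_vanish M P Q n m (f : {linear M -> P})
    (g : {linear P -> M}) :
  short_exact f g -> pd_le P n -> (n <= m)%N -> ext_vanish m M Q ->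
  ext_vanish n M Q.
Proof.
move=> sE Pn /subnK <-; elim: (m - n)%N => [|j IHj] // MQ; apply: IHj.
apply: ext_vanish_sub sE _ MQ; exact: pd_le_ext_vanish Pn (leq_addl _ _).
Qed.
End Dimensions.

Theorem proposition2p3 (R : comPzRingType) (n : nat) :
  let cond1 := SG_ring n R in
  let cond2 :=
    Ggldim_le R n /\
    forall M : lmodType R,
      exists (P : lmodType R) (f : {linear M -> P}) (g : {linear P -> M}),
        short_exact f g /\ pd_finite P in
  let cond3 :=
    Ggldim_finite R /\
    forall M : lmodType R,
      exists (P : lmodType R) (f : {linear M -> P}) (g : {linear P -> M}),
        short_exact f g /\ pd_le P n in
  (cond1 <-> cond2) /\ (cond1 <-> cond3).
Proof.
move=> cond1 cond2 cond3; split; split.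
- move=> SG; split=> [|M]; first exact: SG_ring_Ggldim_le.
  have [[P [f [g [sE Pn]]]] _] := SG M.
  by exists P, f, g; split=> //; exists n.
- move=> [Gn ext] M; have EP := enough_projectives_pd_finite ext.
  split=> [|Q Qproj]; last first.
    exact/(ext_vanish_Ext_eq0 EP)/(Gpd_le_ext_vanish Qproj (Gn M)).
  have [P [f [g [sE Pfin]]]] := ext M; exists P, f, g; split=> //.
  (* The bound on [Ggldim] is applied to [P] rather than to [M], sharpening finite projective
     dimension to at most [n]. *)
  apply: pd_finite_le => // Q j Qproj.
  exact: Gpd_le_ext_vanish Qproj (Gn P).
- move=> SG; split=> [|M]; first by exists n; exact: SG_ring_Ggldim_le.
  by have [] := SG M.
- move=> [[k Gk] ext] M; have EP : enough_projectives R.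
    apply: enough_projectives_pd_finite => N.
    by have [P [f [g [sE Pn]]]] := ext N; exists P, f, g; split=> //; exists n.
  split=> // Q Qproj; apply: ext_vanish_Ext_eq0 EP _.
  have [P [f [g [sE Pn]]]] := ext M.
  (* The descent starts at the maximum of [n] and [k]: at least [k] for the Gorenstein bound on [M],
     at least [n] so that it can come down to [n]. *)
  apply: self_extension_ext_vanish sE Pn (leq_maxl n k) _.
  exact: Gpd_le_ext_vanish Qproj (Gk M) (leq_maxr n k).
Qed.
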